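(* Let $(\Gamma,\alpha)$ be an orientable abstract (unsigned) $T^k$-GKM graph and $G\subset\Gamma$ any subgraph. Then the map $$D_G: H^{*}_T(G)\longrightarrow \mathrm{Hom}_R(H^{*}_{T,c}(G),R);\qquad a\mapsto \Bigl(b\mapsto \int (a\cdot b)\Bigr),$$ is an isomorphism (of $R$-modules).
   Context: Coefficients are $\mathbb{Q}$. Graphs are finite, without loops, possibly with multiple edges. $V(\Gamma)$ is the vertex set; $E(\Gamma)$ contains each edge twice, once for each orientation, so each $e\in E(\Gamma)$ has an initial vertex $i(e)$ and a terminal vertex $t(e)$, and $\overline{e}$ denotes $e$ with opposite orientation. For a vertex $v$, $E_v=\{e\in E(\Gamma): i(e)=v\}$; $\Gamma$ is $d$-valent if $|E_v|=d$ for all $v$. A connection $\nabla$ on $\Gamma$ is a collection of bijections $\nabla_e:E_{i(e)}\to E_{t(e)}$, $e\in E(\Gamma)$, with $\nabla_e(e)=\overline{e}$ and $\nabla_{\overline{e}}=(\nabla_e)^{-1}$. GKM graph: an abstract (unsigned) $T^k$-GKM graph is a pair $(\Gamma,\alpha)$ with $\Gamma$ a connected $d$-valent graph (for some $d$) and $\alpha:E(\Gamma)\to\mathbb{Z}^k/\{\pm1\}$ (with nonzero values) such that (1) $\alpha(\overline{e})=\alpha(e)$ for all $e$; (2) for $v\in V(\Gamma)$ and $e\ne e'$ in $E_v$, the labels $\alpha(e),\alpha(e')$ are linearly independent; (3) there is a compatible connection $\nabla$: for all $e,e'\in E(\Gamma)$ with $i(e)=i(e')$ and some (hence any) lifts $\tilde\alpha(e'),\tilde\alpha(\nabla_e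 e')\in\mathbb{Z}^k$ of $\alpha(e'),\alpha(\nabla_e e')$ there is $\varepsilon\in\{\pm1\}$ with $\tilde\alpha(\nabla_e e')\in\varepsilon\tilde\alpha(e')+\mathbb{Z}\alpha(e)$. A lift of $\pm a$ is either of $a,-a$. Orientability: fix a compatible connection $\nabla$ and a lift $\tilde\alpha:E(\Gamma)\to\mathbb{Z}^k$ of $\alpha$. For $e\in E(\Gamma)$ let $e=e_1,e_2,\ldots,e_d$ be the edges in $E_{i(e)}$; there are unique $k_i\in\mathbb{Z}$, $\varepsilon_i\in\{\pm1\}$ with $\tilde\alpha(\nabla_{e}(e_i))=\varepsilon_i\tilde\alpha(e_i)+k_i\tilde\alpha(e)$ for $i=2,\ldots,d$. Set $\eta(e)=-\prod_{i=2}^d\varepsilon_i$. $\Gamma$ is orientable if $\prod_{i=1}^m\eta(f_i)=1$ for each closed edge path $f_1,\ldots,f_m$; this is independent of the choices of $\nabla$ and $\tilde\alpha$. Graph cohomology of subgraphs: $R=H^*(BT)=\mathbb{Q}[x_1,\ldots,x_k]$ with each $x_i$ in degree $2$; $\mathbb{Z}^k$ is the integer lattice spanned by $x_1,\ldots,x_k$. A subgraph $G\subset\Gamma$ is arbitrary (not necessarily connected or regular), with vertex set $V(G)$ and edge set $E(G)\subset E(\Gamma)$ (closed under $e\mapsto\overline{e}$, endpoints in $V(G)$). Define $$H^*_T(G)=\{(f_v)_v\in R^{V(G)} : \alpha(e)\text{ divides } f_{i(e)}-f_{t(e)}\text{ for all }e\in E(G)\},$$ $$H^*_{T,c}(G)=\{(f_v)_v\in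 H^*_T(G) : \alpha(e)\text{ divides } f_{v}\text{ for all }v\in V(G),\ e\in E_v\setminus E(G)\}.$$ Extension by zero on $V(\Gamma)\setminus V(G)$ gives an inclusion $H^*_{T,c}(G)\subset H^*_T(\Gamma)$. The pointwise product of $a\in H^*_T(G)$ and $b\in H^*_{T,c}(G)$ lies in $H^*_{T,c}(G)\subset H^*_T(\Gamma)$. Integration: let $\Gamma$ be orientable and $d$-valent; fix a vertex $v_0$, a lift $\tilde\alpha$ and a compatible connection (defining $\eta$). For a vertex $w$ put $\Psi(w)=\eta(e_1)\cdots\eta(e_n)\in\{\pm1\}$ for any edge path $e_1,\ldots,e_n$ from $v_0$ to $w$ (well defined by orientability). For $\omega\in H_T^*(\Gamma)$ put $\int\omega=\sum_{w\in V(\Gamma)}\Psi(w)\,\omega_w/\prod_{e\in E_w}\tilde\alpha(e)$. This lies in $R$ and defines an $R$-linear map $\int:H^*_T(\Gamma)\to R^{*-2d}$.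
   Formalization: The lift of the labels is required to take the same value on an edge and on the same edge with opposite orientation; otherwise the integral need not lie in R (single edge with lifts x and −x gives ∫1 = 2/x). *)

(* Defs.v *)
From HB Require Import structures.
From mathcomp Require Import all_boot all_order all_algebra.
From mathcomp Require Import boolp mpoly.

Set Implicit Arguments.
Unset Strict Implicit.
Unset Printing Implicit Defensive.

Import GRing.Theory.
Local Open Scope ring_scope.
Local Open Scope quotient_scope.

(* H^*(BT), where T is the torus of rank k *)
Notation HBT k := {mpoly rat[k]}.

Section SignedVectors.
Variable k : nat.

Definition pm_rel (x y : 'rV[int]_k) : bool := (x == y) || (x == - y).

Lemma pm_rel_is_equiv : equiv_class_of pm_rel.
Proof.
split=> [x | x y | y x z].
- by rewrite /pm_rel eqxx.
- by rewrite /pm_rel eq_sym -[x == - y]eqr_oppLR [- x == y]eq_sym.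
- rewrite /pm_rel => /orP[/eqP-> //|/eqP-> /orP[/eqP->|/eqP->]].
  + by rewrite eqxx orbT.
  + by rewrite opprK eqxx.
Qed.

Canonical pm_equiv := EquivRelPack pm_rel_is_equiv.
Canonical pm_equiv_direct := defaultEncModRel pm_rel.

(* Z^k / {+1, -1} *)
Definition pm_vector := {eq_quot pm_equiv}.
Definition pm_class (x : 'rV[int]_k) : pm_vector := \pi_pm_vector x.

Definition lin_indep (x y : 'rV[int]_k) : Prop :=
  forall a b : int, a *: x + b *: y = 0 -> a = 0 /\ b = 0.

Definition linform (x : 'rV[int]_k) : HBT k := \sum_(j < k) (x 0 j)%:~R *: 'X_j.

Definition label_divides (a : pm_vector) (f : HBT k) : Prop :=
  forall x : 'rV[int]_k, pm_class x = a -> exists g : HBT k, f = g * linform x.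

End SignedVectors.

(* Every edge occurs in [edge] once for each of its two orientations. *)
Record multigraph := Multigraph {
  vertex : finType;
  edge : finType;
  ini : edge -> vertex;
  ter : edge -> vertex;
  bar : edge -> edge;
  barK : involutive bar;
  ini_bar : forall e, ini (bar e) = ter e;
  no_loop : forall e, ini e != ter e
}.

Section Graph.
Variable Gamma : multigraph.
Local Notation V := (vertex Gamma).
Local Notation E := (edge Gamma).

Definition star (v : V) : {set E} := [set e | ini e == v].

Definition valent (d : nat) : Prop := forall v, #|star v| = d.

Fixpoint edge_path (v : V) (p : seq E) (w : V) : bool :=
  if p is e :: p' then (ini e == v) && edge_path (ter e) p' w else v == w.

Definition connected : Prop := forall v w, exists p, edge_path v p w.

(* [nabla e] matters only on [star (ini e)].  The last clause, for [e] and for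
   [bar e], makes it a bijection onto [star (ter e)] whose inverse is
   [nabla (bar e)]. *)
Definition connection (nabla : E -> E -> E) : Prop :=
  [/\ forall e e', e' \in star (ini e) -> nabla e e' \in star (ter e),
      forall e, nabla e e = bar e &
      forall e e', e' \in star (ini e) -> nabla (bar e) (nabla e e') = e'].

Definition compatible (k : nat) (alpha : E -> pm_vector k)
    (nabla : E -> E -> E) : Prop :=
  forall e e', e' \in star (ini e) ->
  forall x y z : 'rV[int]_k,
    pm_class x = alpha e' -> pm_class y = alpha (nabla e e') ->
    pm_class z = alpha e ->
  exists (s : bool) (m : int), y = (-1) ^+ s *: x + m *: z.

End Graph.

Record gkm_graph (k : nat) := GKMGraph {
  gkm_base :> multigraph;
  label : edge gkm_base -> pm_vector k;
  gkm_connected : connected gkm_base;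
  gkm_valent : exists d, valent gkm_base d;
  label_neq0 : forall e, label e <> pm_class 0;
  label_bar : forall e, label (bar e) = label e;
  label_indep : forall v e e', e \in star v -> e' \in star v -> e != e' ->
    forall x y, pm_class x = label e -> pm_class y = label e' ->
    lin_indep x y;
  gkm_connection : exists nabla, connection nabla /\ compatible label nabla
}.

Section Orientation.
Variables (k : nat) (Gamma : gkm_graph k).
Local Notation V := (vertex Gamma).
Local Notation E := (edge Gamma).

Definition compatible_connection (nabla : E -> E -> E) : Prop :=
  connection nabla /\ compatible (@label k Gamma) nabla.

(* A lift takes the same value on both orientations of an edge.  With
   independent signs on [e] and [bar e], orientability would depend on the lift
   and the integral below need not be a polynomial: take a single edge with
   values [x] and [- x] on its two orientations. *)
Definition is_lift (lift : E -> 'rV[int]_k) : Prop :=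
  (forall e, pm_class (lift e) = label e) /\ (forall e, lift (bar e) = lift e).

Section Eta.
Variables (nabla : E -> E -> E) (lift : E -> 'rV[int]_k).

(* For [e' != e] in [star (ini e)], exactly one sign [s] satisfies
   [lift (nabla e e') = s *: lift e' + m *: lift e] for some [m : int]. *)
Definition edge_sign (e e' : E) : int :=
  if `[< exists m : int, lift (nabla e e') = lift e' + m *: lift e >]
  then 1 else -1.

Definition eta (e : E) : int :=
  - \prod_(e' in star (ini e) | e' != e) edge_sign e e'.

End Eta.

Definition orientable : Prop :=
  exists nabla lift, [/\ compatible_connection nabla, is_lift lift &
    forall v p, edge_path v p v -> \prod_(e <- p) eta nabla lift e = 1].

(* Taken along a chosen path; for orientable graphs the choice is irrelevant. *)
Definition Psi nabla lift (v0 w : V) : int :=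
  \prod_(e <- xchoose (gkm_connected v0 w)) eta nabla lift e.

Definition integral nabla lift (v0 : V) (omega : V -> HBT k)
    : {fraction (HBT k)} :=
  \sum_(w : V) (Psi nabla lift v0 w)%:~R * tofrac (omega w)
    / \prod_(e in star w) tofrac (linform (lift e)).

End Orientation.

Record subgraph (Gamma : multigraph) := Subgraph {
  sub_vertex : {set vertex Gamma};
  sub_edge : {set edge Gamma};
  sub_edge_bar : forall e, e \in sub_edge -> bar e \in sub_edge;
  sub_edge_ini : forall e, e \in sub_edge -> ini e \in sub_vertex
}.

Section Cohomology.
Variables (k : nat) (Gamma : gkm_graph k) (G : subgraph Gamma).
Local Notation R := (HBT k).

Definition subV : finType := {v : vertex Gamma | v \in sub_vertex G}.
Definition cochain := {ffun subV -> R^o}.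
HB.instance Definition _ := GRing.Lmodule.on cochain.

Definition is_class (f : cochain) : Prop :=
  forall (e : edge Gamma) (u v : subV), e \in sub_edge G ->
    val u = ini e -> val v = ter e -> label_divides (label e) (f u - f v).

Definition is_compact_class (f : cochain) : Prop :=
  is_class f /\
  forall (u : subV) (e : edge Gamma), e \in star (val u) ->
    e \notin sub_edge G -> label_divides (label e) (f u).

Definition HT_pred : {pred cochain} := fun f => `[< is_class f >].
Definition HTc_pred : {pred cochain} := fun f => `[< is_compact_class f >].

Lemma label_dividesP (a : pm_vector k) (c f g : R) :
  label_divides a f -> label_divides a g -> label_divides a (c * f + g).
Proof.
move=> hf hg x hx; have [p ->] := hf x hx; have [q ->] := hg x hx.
by exists (c * p + q); rewrite mulrDl mulrA.
Qed.

Lemma label_divides0 (a : pm_vector k) : label_divides a 0.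
Proof. by move=> x _; exists 0; rewrite mul0r. Qed.

Lemma HT_submod : submod_closed HT_pred.
Proof.
split=> [|c f g /asboolP hf /asboolP hg]; apply/asboolP=> e u v eG ue ve.
  by rewrite !ffunE subrr; apply: label_divides0.
rewrite !ffunE opprD addrACA -scalerBr.
by apply: label_dividesP; [apply: hf ue ve | apply: hg ue ve].
Qed.

Lemma HTc_submod : submod_closed HTc_pred.
Proof.
split=> [|c f g /asboolP[hf hf'] /asboolP[hg hg']]; apply/asboolP; split.
- by case: HT_submod => /asboolP.
- by move=> u e _ _; rewrite ffunE; apply: label_divides0.
- case: HT_submod => _ /(_ c f g) h.
  by apply/asboolP/h; apply/asboolP.
- move=> u e ue eG; rewrite !ffunE.
  by apply: label_dividesP; [apply: hf' | apply: hg'].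
Qed.

HB.instance Definition _ :=
  GRing.isSubmodClosed.Build R cochain HT_pred HT_submod.
HB.instance Definition _ :=
  GRing.isSubmodClosed.Build R cochain HTc_pred HTc_submod.

Record HT := HTElt { HT_val :> cochain; HT_valP : HT_val \in HT_pred }.
HB.instance Definition _ := [isSub for HT_val].
HB.instance Definition _ := [Choice of HT by <:].
HB.instance Definition _ := [SubChoice_isSubLmodule of HT by <:].

Record HTc := HTcElt { HTc_val :> cochain; HTc_valP : HTc_val \in HTc_pred }.
HB.instance Definition _ := [isSub for HTc_val].
HB.instance Definition _ := [Choice of HTc by <:].
HB.instance Definition _ := [SubChoice_isSubLmodule of HTc by <:].

Definition extend0 (f : subV -> R) (v : vertex Gamma) : R :=
  if insub v is Some u then f u else 0.

End Cohomology.

Section Dual.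
Variables (R : comNzRingType) (M : lmodType R).

Definition dual := {linear M -> R^o}.
HB.instance Definition _ := gen_eqMixin dual.
HB.instance Definition _ := gen_choiceMixin dual.

Lemma dualP (f g : dual) : f =1 g -> f = g.
Proof.
case: f g => [f F] [g G] /= /funext fg; case: g / fg G => G.
congr GRing.Linear.Pack; case: F G => [[a] [b]] [[a'] [b']].
by congr GRing.Linear.Class; congr (_ _); apply: Prop_irrelevance.
Qed.

Let dzero : dual := (\0 : M -> R^o).
Let dopp (f : dual) : dual := (\- (f : {linear M -> R^o})).
Let dadd (f g : dual) : dual :=
  ((f : {linear M -> R^o}) \+ (g : {linear M -> R^o})).
Let dscale (c : R) (f : dual) : dual := (c \*: (f : {linear M -> R^o})).

Let daddA : associative dadd.
Proof. by move=> f g h; apply: dualP => x /=; rewrite addrA. Qed.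
Let daddC : commutative dadd.
Proof. by move=> f g; apply: dualP => x /=; rewrite addrC. Qed.
Let dadd0 : left_id dzero dadd.
Proof. by move=> f; apply: dualP => x /=; rewrite add0r. Qed.
Let daddN : left_inverse dzero dopp dadd.
Proof. by move=> f; apply: dualP => x /=; rewrite addNr. Qed.
HB.instance Definition _ :=
  GRing.isZmodule.Build dual daddA daddC dadd0 daddN.

Let dscaleA (a b : R) (f : dual) : dscale a (dscale b f) = dscale (a * b) f.
Proof. by apply: dualP => x /=; rewrite scalerA. Qed.
Let dscale1 : left_id 1 dscale.
Proof. by move=> f; apply: dualP => x /=; rewrite scale1r. Qed.
Let dscaleDr : right_distributive dscale +%R.
Proof. by move=> a f g; apply: dualP => x /=; rewrite scalerDr. Qed.
Let dscaleDl (f : dual) : {morph dscale^~ f : a b / a + b}.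
Proof. by move=> a b; apply: dualP => x /=; rewrite scalerDl. Qed.
HB.instance Definition _ :=
  GRing.Zmodule_isLmodule.Build R dual dscaleA dscale1 dscaleDr dscaleDl.

Lemma dualDE (f g : dual) x : (f + g) x = f x + g x. Proof. by []. Qed.
Lemma dualZE c (f : dual) x : (c *: f) x = c * f x. Proof. by []. Qed.

End Dual.

(* Main.v *)
(* Fix a lift of the labels.  For an edge e from v to w, let P_e be the product
   of the labels at v other than that of e.  A compatible connection gives
   P_(bar e) = - eta(e) P_e modulo the label of e, and labels are prime elements
   of R, so eta is determined up to coboundary, and eta-holonomy is trivial for
   every choice of connection and lift.

   The integral of a class is a polynomial because it lies in the localization
   at each label l: the edges with label proportional to l form a matching, and
   the congruence above cancels the pole along l in the two terms of each
   matched pair.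

   For the duality, the class delta_v supported at v with value the product of
   the labels at v recovers a_v as Psi(v) int (a delta_v), which gives
   injectivity.  Given a functional phi, set a_v = Psi(v) phi(delta_v).  For an
   edge e of G from v to w, the cochain with values P_e at v and
   - eta(e) P_(bar e) at w is compactly supported, and its product with the
   label of e is delta_v - eta(e) delta_w; hence the label divides a_v - a_w.
   Finally any compactly supported class becomes a combination of the delta_v
   after multiplication by the product of all labels, so a represents phi. *)
From HB Require Import structures.
Require Import Defs.
From mathcomp Require Import all_boot all_order all_algebra.
From mathcomp Require Import boolp mpoly.
Import GRing.Theory.
Local Open Scope ring_scope.

Set Implicit Arguments.
Unset Strict Implicit.
Unset Printing Implicit Defensive.

(** * Linear forms as prime elements of the polynomial ring *)

Section LinearForms.
Variable k : nat.
Local Notation R := (HBT k).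
Implicit Types x y : 'rV[int]_k.

Lemma linformD x y : linform (x + y) = linform x + linform y.
Proof.
rewrite /linform -big_split /=; apply: eq_bigr => j _.
by rewrite mxE rmorphD /= scalerDl.
Qed.

Lemma linformZ (a : int) x : linform (a *: x) = a%:~R * linform x.
Proof.
rewrite /linform mulr_sumr; apply: eq_bigr => j _.
by rewrite mxE rmorphM /= -scalerA scaler_int mulrzl.
Qed.

Lemma mcoeff_linform x j : (linform x)@_U_(j) = (x 0 j)%:~R.
Proof.
rewrite /linform raddf_sum /= (bigD1 j) //= big1 => [|i ij].
  by rewrite mcoeffZ mcoeffXU eqxx mulr1 addr0.
by rewrite mcoeffZ mcoeffXU (negbTE ij) mulr0.
Qed.

Lemma linform_eq0 x : (linform x == 0) = (x == 0).
Proof.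
apply/eqP/eqP => [x0|->]; last first.
  by rewrite /linform big1 // => j _; rewrite mxE scale0r.
apply/rowP => j; rewrite mxE; apply/eqP; rewrite -(intr_eq0 rat).
by rewrite -mcoeff_linform x0 mcoeff0.
Qed.

(* [X_j] is eliminated from [linform x = 0], for some [j] with [x_j != 0];
   the kernel of a morphism to a domain is prime. *)
Lemma linform_quotient x : x != 0 ->
  exists phi : {rmorphism R -> R},
    (forall f, phi f = 0 <-> exists g, f = g * linform x) /\
    (forall y z, phi (linform y) = 0 -> phi (linform z) = 0 ->
      ~ lin_indep y z).
Proof.
move=> x0.
have [j xj0]: exists j, x 0 j != 0.
  apply/existsP; apply: contraR x0 => /existsPn x0; apply/eqP/rowP => j.
  by rewrite mxE; apply/eqP/negbNE/x0.
have xjQ : (x 0 j)%:~R != 0 :> rat by rewrite intr_eq0.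
(* Only ['X_j] moves: it goes to ['X_j - linform x / x_j], which is its value once the equation
   [linform x = 0] is solved for it. *)
pose xi i : R := 'X_i - ((i == j)%:R / (x 0 j)%:~R : rat) *: linform x.
pose phi : {rmorphism R -> R} := comp_mpoly [tuple xi i | i < k].
have phiX i : phi 'X_i = xi i by rewrite /= comp_mpolyXU -tnth_nth tnth_mktuple.
have phiL y : phi (linform y) =
    linform y - ((y 0 j)%:~R / (x 0 j)%:~R : rat) *: linform x.
  rewrite /linform rmorph_sum /= -/(linform x).
  under eq_bigr => i _ do
    rewrite linearZ /= (phiX i) /xi scalerBr scalerA.
  rewrite sumrB; congr (_ - _); rewrite -scaler_suml; congr (_ *: _).
  rewrite (bigD1 j) //= big1 => [|i ij].
    by rewrite eqxx addr0 mul1r.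
  by rewrite (negbTE ij) mul0r mulr0.
have phix : phi (linform x) = 0 by rewrite phiL divff // scale1r subrr.
exists phi; split=> [f|y z].
  split=> [f0|[g ->]]; last by rewrite rmorphM phix mulr0.
  (* [phi] is the identity modulo [linform x]: this holds on the variables and passes to products
     and linear combinations. *)
  pose Q (p : R) := exists g, p - phi p = g * linform x.
  suff [g fg] : Q f by exists g; rewrite -fg f0 subr0.
  have Q1 : Q 1 by exists 0; rewrite rmorph1 subrr mul0r.
  have QM p q : Q p -> Q q -> Q (p * q).
    move=> [g pg] [h qh]; exists (p * h + g * phi q).
    rewrite mulrDl -mulrA -qh mulrAC -pg mulrBr mulrBl addrA subrK.
    by rewrite -rmorphM.
  have QX m : Q 'X_[m].
    rewrite (mpolyXE_id rat m).
    apply: (big_ind Q Q1 QM) => i _.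
    elim: (m i) => [|n IH]; first by rewrite expr0.
    rewrite exprS; apply: QM IH; rewrite /Q (phiX i) /xi.
    by rewrite opprB addrC subrK -mul_mpolyC; eexists.
  elim/mpolyind: {f0} f => [|c m p _ _ [g pg]].
    by exists 0; rewrite rmorph0 subr0 mul0r.
  have [h mh] := QX m; exists (c *: h + g).
  rewrite rmorphD opprD addrACA pg mulrDl -scalerAl -mh scalerBr.
  by rewrite [phi (c *: _)]linearZ.
have proportional t : phi (linform t) = 0 -> x 0 j *: t = t 0 j *: x.
  rewrite phiL => /eqP; rewrite subr_eq0 => /eqP t0; apply/eqP.
  rewrite -subr_eq0 -scaleNr -linform_eq0 linformD !linformZ t0.
  set c := (_ / _ : rat).
  rewrite -scalerAr !mulrzl -!(scaler_int (R := rat)) scalerA divfK //.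
  by rewrite -scalerDl -rmorphD /= subrr scale0r.
move=> y0 z0 yz.
(* Both [y] and [z] are proportional to [x], so these coefficients give a relation. It forces
   [z 0 j = 0], hence [x 0 j *: z = 0], a second relation with a nonzero coefficient. *)
have := yz (z 0 j * x 0 j) (- (y 0 j * x 0 j)).
have hy := proportional y y0; have hz := proportional z z0.
rewrite scaleNr -!scalerA hy hz !scalerA mulrC subrr.
move=> /(_ erefl)[/eqP]; rewrite mulf_eq0 (negbTE xj0) orbF => /eqP zj0 _.
move: hz; rewrite zj0 scale0r => xz.
have := yz 0 (x 0 j); rewrite scale0r xz addr0 => /(_ erefl)[_ /eqP].
by rewrite (negbTE xj0).
Qed.

End LinearForms.

Lemma mpoly_intr_eq0 k (n : int) : ((n%:~R : HBT k) == 0) = (n == 0).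
Proof. by rewrite -(rmorph_int (@mpolyC k rat)) mpolyC_eq0 intr_eq0. Qed.

Lemma pm_classP k (x y : 'rV[int]_k) :
  pm_class x = pm_class y <-> x = y \/ x = - y.
Proof.
split=> [/eqmodP /orP[/eqP|/eqP]|xy]; [by left|by right|].
by apply/eqmodP; rewrite /= /pm_rel; case: xy => ->; rewrite eqxx ?orbT.
Qed.

Section Multigraph.
Variable Gamma : multigraph.
Implicit Types e : edge Gamma.

Lemma ter_bar e : ter (bar e) = ini e.
Proof. by rewrite -ini_bar barK. Qed.

Lemma star_ini e : e \in star (ini e).
Proof. by rewrite inE. Qed.

Lemma star_ter e : bar e \in star (ter e).
Proof. by rewrite inE ini_bar. Qed.

Lemma edge_path_cat u v p w q :
  @edge_path Gamma u p v -> edge_path v q w -> edge_path u (p ++ q) w.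
Proof.
elim: p u => [|e p IH] u /=; first by move=> /eqP->.
by case/andP=> -> /IH h /h.
Qed.

End Multigraph.

(** * Products of labels at a vertex and the sign [eta] *)

Section Signs.
Variables (k : nat) (Gamma : gkm_graph k).
Local Notation V := (vertex Gamma).
Local Notation E := (edge Gamma).
Local Notation R := (HBT k).
Implicit Types (lift : E -> 'rV[int]_k) (e : E) (v : V).
Implicit Types phi : {rmorphism R -> R}.

Definition star_prod lift v : R := \prod_(e in star v) linform (lift e).

Definition punctured_prod lift e : R :=
  \prod_(e' in star (ini e) | e' != e) linform (lift e').

Lemma star_prodE lift e :
  star_prod lift (ini e) = linform (lift e) * punctured_prod lift e.
Proof. by rewrite /star_prod (bigD1 e) ?star_ini. Qed.

Lemma star_prod_ter lift e : is_lift lift ->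
  star_prod lift (ter e) = linform (lift e) * punctured_prod lift (bar e).
Proof. by case=> _ lb; rewrite -ini_bar star_prodE lb. Qed.

Lemma lift_neq0 lift e : is_lift lift -> lift e != 0.
Proof.
case=> hl _; apply/eqP => le0; apply: (@label_neq0 _ Gamma e).
by rewrite -hl le0.
Qed.

Lemma linform_lift_neq0 lift e : is_lift lift -> linform (lift e) != 0.
Proof. by move=> hl; rewrite linform_eq0 lift_neq0. Qed.

Lemma star_prod_neq0 lift v : is_lift lift -> star_prod lift v != 0.
Proof.
by move=> hl; apply/prodf_neq0 => e _; apply: linform_lift_neq0.
Qed.

Lemma label_dividesE lift e (f : R) : is_lift lift ->
  label_divides (label e) f <-> exists g, f = g * linform (lift e).
Proof.
move=> [hl _]; split=> [h|[g ->] x]; first by apply: h.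
rewrite -hl => /pm_classP[->|->]; first by exists g.
by exists (- g); rewrite -[- lift e]scaleN1r linformZ mulrN1z mulN1r mulrNN.
Qed.

(** Forms killed by [phi] are dependent, while distinct edges at a vertex have independent labels.
    So [phi] kills at most one label per vertex, which is the matching property. *)
Lemma lift_quotient lift e : is_lift lift ->
  exists phi : {rmorphism R -> R},
    (forall f, phi f = 0 <-> exists g, f = g * linform (lift e)) /\
    (forall e1 e2, phi (linform (lift e1)) = 0 -> phi (linform (lift e2)) = 0 ->
       ini e1 = ini e2 -> e1 = e2).
Proof.
move=> hl; have [phi [phiP phi_dep]] := linform_quotient (lift_neq0 e hl).
exists phi; split=> // e1 e2 h1 h2 e12; apply: contrapT => /eqP ne12.
apply: (phi_dep _ _ h1 h2).
apply: (label_indep (star_ini e1) _ ne12 (hl.1 e1) (hl.1 e2)).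
by rewrite inE e12.
Qed.

Lemma punctured_prod_quotient_neq0 lift phi e :
  (forall e1 e2, phi (linform (lift e1)) = 0 -> phi (linform (lift e2)) = 0 ->
     ini e1 = ini e2 -> e1 = e2) ->
  phi (linform (lift e)) = 0 -> phi (punctured_prod lift e) != 0.
Proof.
move=> phi_inj phie; rewrite rmorph_prod; apply/prodf_neq0 => e'.
rewrite inE => /andP[/eqP ee' ne]; apply: contra ne => /eqP phie'.
by apply/eqP/phi_inj.
Qed.

Lemma edge_signP nabla lift e e' :
  compatible_connection nabla -> is_lift lift -> e' \in star (ini e) ->
  exists m : int, lift (nabla e e') =
    edge_sign nabla lift e e' *: lift e' + m *: lift e.
Proof.
move=> [_ hn] [hl _] ee'; rewrite /edge_sign; case: asboolP => [[m ->]|ns].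
  by exists m; rewrite scale1r.
have [s [m hm]] := hn e e' ee' _ _ _ (hl e') (hl (nabla e e')) (hl e).
by exists m; case: s hm => // hm; case: ns; exists m; rewrite hm scale1r.
Qed.

Lemma eta_sqr nabla lift e : eta nabla lift e * eta nabla lift e = 1.
Proof.
rewrite /eta mulrNN -big_split big1 //= => e' _.
by rewrite /edge_sign; case: ifP; rewrite ?mulr1 ?mulrNN ?mulr1.
Qed.

(** The map [nabla e] carries the edges at [ini e] other than [e] bijectively to those at [ter e]
    other than [bar e]. Modulo the label of [e], each factor changes by its [edge_sign]; the minus
    undoes the one in [eta]. *)
Lemma punctured_prod_bar nabla lift phi e :
  compatible_connection nabla -> is_lift lift -> phi (linform (lift e)) = 0 ->
  phi (punctured_prod lift (bar e)) =
    - (eta nabla lift e)%:~R * phi (punctured_prod lift e).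
Proof.
move=> hn hl phie; have [[hs he hb] _] := hn.
have -> : punctured_prod lift (bar e) =
    \prod_(e' in star (ini e) | e' != e) linform (lift (nabla e e')).
  rewrite /punctured_prod (reindex_onto (nabla e) (nabla (bar e))) /=.
    apply: eq_bigl => e'; apply/idP/idP.
      case/andP=> /andP[]; rewrite ini_bar => e'1 ne /eqP e'2.
      have := hs (bar e) (nabla e e'); rewrite ini_bar e'2 ter_bar => -> //.
      by apply: contra ne => /eqP->; rewrite he.
    case/andP=> e'1 ne; rewrite ini_bar hs // hb // eqxx !andbT /=.
    apply: contra ne => /eqP ne; have := hb _ _ e'1.
    by rewrite ne he barK => ->.
  by move=> e' /andP[e'1 _]; rewrite -{1}[e]barK hb.
rewrite /eta mulrNz opprK !rmorph_prod /= -big_split /=.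
apply: eq_bigr => e' /andP[e'1 _].
have [m ->] := edge_signP hn hl e'1.
by rewrite linformD !linformZ rmorphD !rmorphM /= phie mulr0 addr0 rmorph_int.
Qed.

(** * Independence of holonomy from the connection and the lift *)

Section ChangeOfLift.
Variables (nabla nabla0 : E -> E -> E) (lift lift0 : E -> 'rV[int]_k).
Hypotheses (hn : compatible_connection nabla) (hl : is_lift lift).
Hypotheses (hn0 : compatible_connection nabla0) (hl0 : is_lift lift0).

Let sgn e : int := if lift e == lift0 e then 1 else -1.

Let sgn_sqr e : sgn e * sgn e = 1.
Proof. by rewrite /sgn; case: ifP; rewrite ?mulrNN mulr1. Qed.

Let sgn_bar e : sgn (bar e) = sgn e.
Proof. by rewrite /sgn hl.2 hl0.2. Qed.

Let lift_sgn e : lift e = sgn e *: lift0 e.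
Proof.
rewrite /sgn; case: eqP => [->|ne]; first by rewrite scale1r.
have /pm_classP[//|->] : pm_class (lift e) = pm_class (lift0 e).
  by rewrite hl.1 hl0.1.
by rewrite scaleN1r.
Qed.

Let star_sgn v := \prod_(e in star v) sgn e.
Let punctured_sgn e := \prod_(e' in star (ini e) | e' != e) sgn e'.

Let star_sgnE e : star_sgn (ini e) = sgn e * punctured_sgn e.
Proof. by rewrite /star_sgn (bigD1 e) ?star_ini. Qed.

Let punctured_sgn_sqr e : punctured_sgn e * punctured_sgn e = 1.
Proof. by rewrite -big_split big1 //= => e' _; rewrite sgn_sqr. Qed.

Let star_sgn_sqr v : star_sgn v * star_sgn v = 1.
Proof. by rewrite -big_split big1 //= => e' _; rewrite sgn_sqr. Qed.

Let punctured_prod_sgn e :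
  punctured_prod lift e = (punctured_sgn e)%:~R * punctured_prod lift0 e.
Proof.
rewrite rmorph_prod -big_split /=; apply: eq_bigr => e' _.
by rewrite -linformZ -lift_sgn.
Qed.

(* Modulo the label of [e], the sign [eta e] is the only constant relating the
   punctured products at its two ends, so [eta] depends on the lift alone, and
   on it only through a coboundary. *)
Lemma eta_change_lift e :
  eta nabla lift e = star_sgn (ini e) * star_sgn (ter e) * eta nabla0 lift0 e.
Proof.
have [phi [phiP phi_inj]] := lift_quotient e hl0.
have phi0 : phi (linform (lift0 e)) = 0 by apply/phiP; exists 1; rewrite mul1r.
have phil : phi (linform (lift e)) = 0.
  by rewrite lift_sgn linformZ rmorphM phi0 mulr0.
have nz := punctured_prod_quotient_neq0 phi_inj phi0.
have := punctured_prod_bar hn hl phil.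
rewrite !punctured_prod_sgn !rmorphM !rmorph_int /=.
rewrite (punctured_prod_bar hn0 hl0 phi0) !mulNr mulrN !mulrA => /oppr_inj.
(* Cancelling the nonzero punctured product leaves an equality of integer constants, valid in the
   integers by characteristic zero. *)
move/(mulIf nz)/eqP; rewrite -!intrM -subr_eq0 -intrB mpoly_intr_eq0.
rewrite subr_eq0 => /eqP h.
have -> : eta nabla lift e =
    punctured_sgn e * (punctured_sgn (bar e) * eta nabla0 lift0 e).
  by rewrite h mulrCA punctured_sgn_sqr mulr1.
rewrite -(ini_bar e) !star_sgnE sgn_bar.
by rewrite mulrACA sgn_sqr mul1r mulrA.
Qed.

(** The coboundary telescopes: the sign of each intermediate vertex occurs twice. *)
Let path_holonomy_change_lift v p w : edge_path v p w ->
  \prod_(e <- p) eta nabla lift e =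
  star_sgn v * star_sgn w * \prod_(e <- p) eta nabla0 lift0 e.
Proof.
elim: p v => [|e p IH] v /=.
  by move=> /eqP->; rewrite !big_nil star_sgn_sqr.
case/andP=> /eqP <- /IH pw; rewrite !big_cons pw eta_change_lift.
rewrite mulrACA; congr (_ * _).
by rewrite -mulrA [X in _ * X]mulrA star_sgn_sqr mul1r.
Qed.

Lemma holonomy_change_lift v p : edge_path v p v ->
  \prod_(e <- p) eta nabla lift e = \prod_(e <- p) eta nabla0 lift0 e.
Proof. by move/path_holonomy_change_lift->; rewrite star_sgn_sqr mul1r. Qed.

End ChangeOfLift.

(** * The vertex signs [Psi] *)

Section Psi.
Hypothesis hGamma : orientable Gamma.
Variables (nabla : E -> E -> E) (lift : E -> 'rV[int]_k) (v0 : V).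
Hypotheses (hn : compatible_connection nabla) (hl : is_lift lift).
Local Notation Psi := (Psi nabla lift v0).

(** [orientable] provides just one pair with trivial holonomy; a closed path does not see the
    coboundary, so the given pair inherits it. *)
Lemma holonomy_closed v p : edge_path v p v ->
  \prod_(e <- p) eta nabla lift e = 1.
Proof.
case: hGamma => nabla0 [lift0 [hn0 hl0 h0]] vp.
by rewrite (holonomy_change_lift hn hl hn0 hl0 vp) (h0 _ _ vp).
Qed.

Lemma Psi_sqr v : Psi v * Psi v = 1.
Proof. by rewrite -big_split big1 //= => e _; apply: eta_sqr. Qed.

Lemma Psi_ter e : Psi (ter e) = Psi (ini e) * eta nabla lift e.
Proof.
(* One return path [q] closes both the chosen path to [ter e] and the chosen path to [ini e]
   followed by [e]; comparing the two trivial holonomies cancels [q]. *)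
have [q qP] := gkm_connected (ter e) v0.
have pP := xchooseP (gkm_connected v0 (ini e)).
have p'P := xchooseP (gkm_connected v0 (ter e)).
have /holonomy_closed := edge_path_cat p'P qP.
have /holonomy_closed : edge_path v0
    (xchoose (gkm_connected v0 (ini e)) ++ e :: q) v0.
  by apply: edge_path_cat pP _; rewrite /= eqxx.
rewrite !big_cat big_cons /= mulrA -/(Psi (ini e)) -/(Psi (ter e)).
set c := \prod_(_ <- q) _ => h1 h2.
have c0 : c != 0.
  by apply/eqP => c0; move: h2; rewrite c0 mulr0 => /eqP.
by apply: (mulIf c0); rewrite h2 h1.
Qed.

End Psi.

End Signs.

(** * Fractions without poles along given primes *)

Section LocalFractions.
Variable R : idomainType.
Implicit Types (p q : R) (x y : {fraction R}) (phi : {rmorphism R -> R}).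

Lemma tofrac_inj : injective (@tofrac R).
Proof. by move=> p q /eqP; rewrite tofrac_eq => /eqP. Qed.

(* [x] lies in the localization of [R] at the kernel of [phi]. *)
Definition local_at phi x : Prop :=
  exists p q, phi q != 0 /\ x * tofrac q = tofrac p.

Lemma local_at0 phi : local_at phi 0.
Proof. by exists 0, 1; rewrite rmorph1 oner_neq0 mul0r rmorph0. Qed.

Lemma local_atD phi x y :
  local_at phi x -> local_at phi y -> local_at phi (x + y).
Proof.
move=> [p [q [q0 xq]]] [p' [q' [q'0 yq']]].
exists (p * q' + p' * q), (q * q'); rewrite rmorphM mulf_neq0 //; split=> //.
rewrite mulrDl !rmorphD !rmorphM /= -xq -yq' !mulrA.
by congr (_ + _); rewrite mulrAC.
Qed.

Lemma local_at_div phi p q : phi q != 0 -> local_at phi (tofrac p / tofrac q).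
Proof.
move=> q0; exists p, q; split=> //; rewrite divfK // tofrac_eq0.
by apply: contra q0 => /eqP->; rewrite rmorph0.
Qed.

Lemma tofrac_addf_div (a b l p q g : R) : l != 0 -> p != 0 -> q != 0 ->
  a * q + b * p = g * l ->
  tofrac a / tofrac (l * p) + tofrac b / tofrac (l * q) =
  tofrac g / tofrac (p * q).
Proof.
move=> l0 p0 q0 gE; have F0 r : r != 0 -> tofrac r != 0.
  by rewrite tofrac_eq0.
rewrite addf_div ?F0 ?mulf_neq0 //; apply/eqP.
rewrite eqr_div ?mulf_neq0 ?F0 ?mulf_neq0 // -!tofracM -tofracD -!tofracM.
apply/eqP; congr tofrac.
have -> : a * (l * q) + b * (l * p) = l * (g * l).
  by rewrite -gE mulrDr !(mulrCA l).
by rewrite [in RHS]mulrACA (mulrCA l g) -[LHS]mulrA.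
Qed.

(** The primes are removed from the denominator one at a time: locality at [l i] gives a multiple
    [p * q] of [l i] with [q] outside that prime, so [l i] divides [p]. Repeated primes are
    allowed. *)
Lemma fraction_integral (I : eqType) (s : seq I) (l : I -> R) x :
  (forall i, i \in s -> l i != 0 /\ exists phi : {rmorphism R -> R},
    (forall f, phi f = 0 <-> exists g, f = g * l i) /\ local_at phi x) ->
  (exists p, x * tofrac (\prod_(i <- s) l i) = tofrac p) ->
  exists p, x = tofrac p.
Proof.
elim: s => [|i s IH] hs; first by rewrite big_nil rmorph1 mulr1.
rewrite big_cons => -[p xp]; apply: IH => [j js|].
  by apply: hs; rewrite inE js orbT.
have [li0 [phi [phiP [p' [q [q0 xq]]]]]] := hs i (mem_head _ _).
have : phi (p * q) = 0.
  apply/phiP; exists (p' * \prod_(j <- s) l j); apply: tofrac_inj.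
  rewrite !rmorphM /= -xp -xq rmorphM mulrAC -[in RHS]mulrA.
  by congr (_ * _); apply: mulrC.
rewrite rmorphM => /eqP; rewrite mulf_eq0 (negbTE q0) orbF => /eqP.
case/phiP=> g gE; exists g; have li0F : tofrac (l i) != 0 by rewrite tofrac_eq0.
apply: (mulIf li0F); rewrite -[RHS]tofracM -gE -xp tofracM -mulrA.
by congr (_ * _); apply: mulrC.
Qed.

End LocalFractions.

(** * The integral of a class is a polynomial *)

Section Integrality.
Variables (k : nat) (Gamma : gkm_graph k).
Local Notation V := (vertex Gamma).
Local Notation E := (edge Gamma).
Local Notation R := (HBT k).
Hypothesis hGamma : orientable Gamma.
Variables (nabla : E -> E -> E) (lift : E -> 'rV[int]_k) (v0 : V).
Hypotheses (hn : compatible_connection nabla) (hl : is_lift lift).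
Local Notation Psi := (Psi nabla lift v0).

Lemma integralE (omega : V -> R) : integral nabla lift v0 omega =
  \sum_w tofrac ((Psi w)%:~R * omega w) / tofrac (star_prod lift w).
Proof.
apply: eq_bigr => w _; rewrite tofracM (rmorph_int (@tofrac _)).
by congr (_ / _); rewrite rmorph_prod.
Qed.

Section Class.
Variable omega : V -> R.
Hypothesis homega :
  forall e, label_divides (label e) (omega (ini e) - omega (ter e)).

Section Localization.
Variable phi : {rmorphism R -> R}.
Hypothesis phi_inj : forall e1 e2 : E,
  phi (linform (lift e1)) = 0 -> phi (linform (lift e2)) = 0 ->
  ini e1 = ini e2 -> e1 = e2.

(** By [phi_inj] the picked edge is the only candidate, so [mate] is the involution of the matching,
    fixing unmatched vertices. *)
Let mate w :=
  if [pick e in star w | phi (linform (lift e)) == 0] is Some e then ter e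
  else w.

Let term w := tofrac ((Psi w)%:~R * omega w) / tofrac (star_prod lift w).

Let mate_ini e : phi (linform (lift e)) = 0 -> mate (ini e) = ter e.
Proof.
move=> he; rewrite /mate; case: pickP => [e' /andP[]|/(_ e)].
  by rewrite inE => /eqP ee' /eqP he'; rewrite (phi_inj he' he ee').
by rewrite star_ini he eqxx.
Qed.

Let mateK : involutive mate.
Proof.
move=> w; rewrite [X in mate X]/mate; case: pickP => [e /andP[]|none].
  rewrite inE => /eqP<- /eqP he.
  by rewrite -ini_bar mate_ini ?ter_bar // hl.2.
by rewrite /mate; case: pickP => // e; rewrite none.
Qed.

Let local_at_mates w : local_at phi (term w + term (mate w)).
Proof.
rewrite [X in _ + term X]/mate; case: pickP => [e /andP[]|none]; last first.
  have w0 : phi (star_prod lift w) != 0.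
    rewrite rmorph_prod; apply/prodf_neq0 => e we.
    by have := none e; rewrite we /= => ->.
  by apply: local_atD; apply: local_at_div.
rewrite inE => /eqP<- /eqP he; have hbe := he; rewrite -(hl.2 e) in hbe.
have p0 := punctured_prod_quotient_neq0 phi_inj he.
have pb0 := punctured_prod_quotient_neq0 phi_inj hbe.
set p := punctured_prod lift e in p0.
set pb := punctured_prod lift (bar e) in pb0.
(* The kernel of [phi] is not assumed principal, so divisibility by the label of [e] is tested with
   [psi], whose kernel is generated by that label. *)
have [psi [psiP psi_inj]] := lift_quotient e hl.
have psi0 : psi (linform (lift e)) = 0 by apply/psiP; exists 1; rewrite mul1r.
have [g gE] : exists g,
    omega (ini e) * pb + (eta nabla lift e)%:~R * omega (ter e) * p =
    g * linform (lift e).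
  apply/psiP; rewrite rmorphD !rmorphM rmorph_int /=.
  rewrite (punctured_prod_bar hn hl psi0).
  have /(label_dividesE _ _ hl)/psiP/eqP := homega (e := e).
  rewrite rmorphB subr_eq0 => /eqP->.
  by rewrite mulNr mulrN mulrA [X in _ + X * _]mulrC addNr.
have -> : term (ini e) + term (ter e) =
    tofrac ((Psi (ini e))%:~R * g) / tofrac (p * pb).
  have l0 := linform_lift_neq0 e hl.
  have nz q : phi q != 0 -> q != 0.
    by apply: contra => /eqP->; rewrite rmorph0.
  rewrite /term Psi_ter // star_prodE star_prod_ter // -/p -/pb.
  apply: tofrac_addf_div; [exact: l0 | exact: nz | exact: nz |].
  by rewrite -[RHS]mulrA -gE intrM mulrDr !mulrA.
by apply: local_at_div; rewrite rmorphM mulf_neq0.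
Qed.

Lemma integral_local : local_at phi (integral nabla lift v0 omega).
Proof.
rewrite integralE -/term.
(* Pairing each vertex with its mate counts every term twice. *)
have [p [q [q0 hpq]]] : local_at phi (\sum_w (term w + term (mate w))).
  by apply: (big_ind (local_at phi)) => [|x y|w _];
    [exact: local_at0 | exact: local_atD | exact: local_at_mates].
exists p, (2%:R * q); split.
  rewrite rmorphM rmorph_nat mulf_neq0 //.
  by rewrite (mpoly_intr_eq0 _ 2).
have mateE : \sum_w term (mate w) = \sum_w term w.
  by rewrite [RHS](reindex_inj (inv_inj mateK)).
rewrite -hpq big_split /= mateE -mulr2n.
by rewrite [RHS]mulrnAl -[RHS]mulrnAr mulr_natl tofracMn.
Qed.

End Localization.

Lemma integral_mul_labels : exists p,
  integral nabla lift v0 omega * tofrac (\prod_e linform (lift e)) = tofrac p.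
Proof.
exists (\sum_w (Psi w)%:~R * omega w *
  \prod_(e | e \notin star w) linform (lift e)).
rewrite integralE mulr_suml rmorph_sum; apply: eq_bigr => w _ /=.
rewrite [in LHS](bigID (mem (star w))) /= -/(star_prod lift w) !rmorphM /=.
by rewrite mulrA divfK // tofrac_eq0 star_prod_neq0.
Qed.

Lemma integral_polynomial : exists p, integral nabla lift v0 omega = tofrac p.
Proof.
apply: fraction_integral integral_mul_labels => e _.
split; first exact: linform_lift_neq0.
have [phi [phiP phi_inj]] := lift_quotient e hl.
by exists phi; split=> //; apply: integral_local.
Qed.

End Class.

End Integrality.

(** * The pairing and its linearity *)

Section Duality.
Variables (k : nat) (Gamma : gkm_graph k).
Local Notation V := (vertex Gamma).
Local Notation E := (edge Gamma).
Local Notation R := (HBT k).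
Hypothesis hGamma : orientable Gamma.
Variables (nabla : E -> E -> E) (lift : E -> 'rV[int]_k) (v0 : V).
Hypotheses (hn : compatible_connection nabla) (hl : is_lift lift).
Variable G : subgraph Gamma.
Local Notation Psi := (Psi nabla lift v0).
Implicit Types (a : HT G) (b : HTc G) (u v x : subV G) (e : E).

Lemma label_dividesM (l : pm_vector k) (c f : R) :
  label_divides l f -> label_divides l (c * f).
Proof.
move=> h; rewrite -[c * f]addr0; apply: label_dividesP h _.
exact: label_divides0.
Qed.

Lemma label_dividesD (l : pm_vector k) (f g : R) :
  label_divides l f -> label_divides l g -> label_divides l (f + g).
Proof. by rewrite -[f in f + g]mul1r; apply: label_dividesP. Qed.

Lemma label_dividesN (l : pm_vector k) (f : R) :
  label_divides l f -> label_divides l (- f).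
Proof. by rewrite -mulN1r; apply: label_dividesM. Qed.

Lemma extend0E (f : subV G -> R) u : extend0 f (val u) = f u.
Proof. by rewrite /extend0 valK. Qed.

Lemma extend0_out (f : subV G -> R) w :
  w \notin sub_vertex G -> extend0 f w = 0.
Proof. by move=> wG; rewrite /extend0 insubN. Qed.

Lemma subV_exists w : w \in sub_vertex G -> exists u : subV G, val u = w.
Proof.
by move=> wG; exists (exist _ w wG : {w' : V | w' \in sub_vertex G}).
Qed.

(** For an edge outside [G] the label divides the value at each end separately: by compact support
    at a vertex of [G], and because the value is zero elsewhere. *)
Lemma extend0_class (f : subV G -> R) :
  is_compact_class [ffun u => f u] ->
  forall e, label_divides (label e) (extend0 f (ini e) - extend0 f (ter e)).
Proof.
move=> [hf hfc] e; have [eG|eG] := boolP (e \in sub_edge G).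
  have iG := sub_edge_ini eG.
  have tG := sub_edge_ini (sub_edge_bar eG); rewrite ini_bar in tG.
  have [[u ue] [v ve]] := (subV_exists iG, subV_exists tG).
  by have := hf e u v eG ue ve; rewrite !ffunE -!extend0E ue ve.
have outer e' : e' \notin sub_edge G ->
    label_divides (label e') (extend0 f (ini e')).
  move=> e'G; have [iG|iG] := boolP (ini e' \in sub_vertex G); last first.
    by rewrite extend0_out //; apply: label_divides0.
  have [u ue] := subV_exists iG; have := hfc u e'.
  by rewrite ue ffunE -extend0E ue; apply; first exact: star_ini.
apply: label_dividesD; first exact: outer.
apply: label_dividesN; rewrite -label_bar -ini_bar; apply: outer.
by apply: contra eG => /sub_edge_bar; rewrite barK.
Qed.

Lemma HT_class a : is_class (val a).
Proof. by apply/asboolP/(HT_valP a). Qed.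

Lemma HTc_compact_class b : is_compact_class (val b).
Proof. by apply/asboolP/(HTc_valP b). Qed.

Lemma mul_compact_class a b :
  is_compact_class [ffun u => val a u * val b u].
Proof.
have [hb hbc] := HTc_compact_class b; have ha := HT_class a.
split=> [e u v eG ue ve|u e ue eG]; rewrite !ffunE; last first.
  by apply/label_dividesM/hbc.
have -> : val a u * val b u - val a v * val b v =
    val a u * (val b u - val b v) + val b v * (val a u - val a v).
  rewrite !mulrBr addrA [val b v * _]mulrC [val b v * _]mulrC.
  by rewrite subrK.
by apply: label_dividesP; [apply: hb ue ve | apply/label_dividesM/(ha e)].
Qed.

Lemma integral_extend0 (f : subV G -> R) : integral nabla lift v0 (extend0 f) =
  \sum_u tofrac ((Psi (val u))%:~R * f u) / tofrac (star_prod lift (val u)).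
Proof.
rewrite integralE (bigID (mem (sub_vertex G))) /= [X in _ + X]big1 ?addr0.
  by rewrite big_sub; apply: eq_bigr => u _; rewrite -[f u]extend0E.
by move=> w wG; rewrite extend0_out // mulr0 rmorph0 mul0r.
Qed.

Definition pairing a b : R :=
  projT1 (cid (integral_polynomial hGamma v0 hn hl
    (extend0_class (mul_compact_class a b)))).

Lemma pairingE a b : tofrac (pairing a b) =
  integral nabla lift v0 (extend0 (fun u => val a u * val b u)).
Proof. by rewrite /pairing; case: cid. Qed.

Lemma pairing_linear_r a : linear (pairing a : HTc G -> R^o).
Proof.
move=> c b b'.
change (pairing a (c *: b + b') = c * pairing a b + pairing a b').
apply: (@tofrac_inj R); rewrite tofracD tofracM !pairingE !integral_extend0.
rewrite mulr_sumr -big_split; apply: eq_bigr => u _ /=.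
rewrite [tofrac c * _]mulrA -mulrDl -tofracM -tofracD; congr (tofrac _ / _).
rewrite !ffunE [_ *: _]/(c * val b u).
by rewrite !mulrDr; congr (_ + _); rewrite [val a u * _]mulrCA [LHS]mulrCA.
Qed.

HB.instance Definition _ a :=
  GRing.isLinear.Build R (HTc G) R^o *:%R (pairing a) (pairing_linear_r a).

Definition duality a : dual (HTc G) := (pairing a : HTc G -> R^o).

Lemma duality_linear : linear duality.
Proof.
move=> c a a'; apply: dualP => b; apply: (@tofrac_inj R).
rewrite dualDE dualZE /=.
rewrite tofracD tofracM !pairingE !integral_extend0.
rewrite mulr_sumr -big_split; apply: eq_bigr => u _ /=.
rewrite [tofrac c * _]mulrA -mulrDl -tofracM -tofracD; congr (tofrac _ / _).
rewrite !ffunE [_ *: _]/(c * val a u).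
by rewrite mulrDl mulrDr; congr (_ + _); rewrite -mulrA [LHS]mulrCA.
Qed.

HB.instance Definition _ :=
  GRing.isLinear.Build R (HT G) (dual (HTc G)) *:%R duality duality_linear.

(** * Point classes and injectivity *)

Lemma star_prod_dvd e (w : V) : e \in star w ->
  label_divides (label e) (star_prod lift w).
Proof.
rewrite inE => /eqP<-; apply/(label_dividesE _ _ hl).
by exists (punctured_prod lift e); rewrite star_prodE mulrC.
Qed.

Lemma punctured_prod_dvd e e' : e' \in star (ini e) -> e' != e ->
  label_divides (label e') (punctured_prod lift e).
Proof.
move=> ee' ne; apply/(label_dividesE _ _ hl).
rewrite /punctured_prod (bigD1 e') ?ee' //= mulrC; eexists; reflexivity.
Qed.

Definition point_cochain u : cochain G :=
  [ffun x => if x == u then star_prod lift (val u) else 0].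

Lemma point_cochain_compact u : point_cochain u \in @HTc_pred k Gamma G.
Proof.
have dvd x e : e \in star (val x) ->
    label_divides (label e) (point_cochain u x).
  move=> ex; rewrite ffunE; case: eqP => [<-|_]; first exact: star_prod_dvd.
  exact: label_divides0.
apply/asboolP; split=> [e x y _ xe ye|x e ex _]; last exact: dvd.
apply: label_dividesD; first by apply: dvd; rewrite xe star_ini.
by apply: label_dividesN; rewrite -label_bar; apply: dvd; rewrite ye star_ter.
Qed.

Definition point_class u : HTc G := HTcElt (point_cochain_compact u).

(** The value of the point class is exactly the denominator of the only surviving term. *)
Lemma pairing_point a u :
  pairing a (point_class u) = (Psi (val u))%:~R * val a u.
Proof.
apply: (@tofrac_inj R); rewrite pairingE integral_extend0 (bigD1 u) //= big1.
  rewrite ffunE eqxx addr0 mulrA [tofrac (_ * star_prod _ _)]tofracM mulfK //.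
  by rewrite tofrac_eq0 star_prod_neq0.
by move=> x xu; rewrite ffunE (negbTE xu) !mulr0 rmorph0 mul0r.
Qed.

Lemma PsiR_sqr w : (Psi w)%:~R * (Psi w)%:~R = 1 :> R.
Proof. by rewrite -intrM Psi_sqr. Qed.

Lemma duality_inj : injective duality.
Proof.
move=> a a' aa'; apply/val_inj/ffunP => u.
have : pairing a (point_class u) = pairing a' (point_class u).
  exact: (congr1 (fun f : dual (HTc G) => f (point_class u)) aa').
rewrite !pairing_point => /(congr1 ( *%R (Psi (val u))%:~R)).
by rewrite !mulrA PsiR_sqr !mul1r.
Qed.

(** * Compactly supported classes on a single edge *)

Section EdgeClass.
Variables (e : E) (u v : subV G).
Hypotheses (eG : e \in sub_edge G) (ue : val u = ini e) (ve : val v = ter e).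

Let vu : v != u.
Proof. by rewrite -val_eqE ue ve eq_sym no_loop. Qed.

Definition edge_cochain : cochain G :=
  [ffun x =>
    if x == u then punctured_prod lift e else
    if x == v then - (eta nabla lift e)%:~R * punctured_prod lift (bar e)
    else 0].

(** The punctured products contain every label at the two ends except that of [e]. Since [e] lies in
    [G], only a congruence along [e] remains, and the factor [- eta] supplies it through
    [punctured_prod_bar]. *)
Lemma edge_cochain_compact : edge_cochain \in @HTc_pred k Gamma G.
Proof.
have dvd x e' : e' \in star (val x) -> e' != e -> e' != bar e ->
    label_divides (label e') (edge_cochain x).
  move=> xe' ne neb; rewrite ffunE; case: eqP => [xu|_].
    by apply: punctured_prod_dvd => //; rewrite -ue -xu.
  case: eqP => [xv|_]; last exact: label_divides0.
  by apply/label_dividesM/punctured_prod_dvd; rewrite // ini_bar -ve -xv.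
have along : label_divides (label e) (edge_cochain u - edge_cochain v).
  have [phi [phiP _]] := lift_quotient e hl.
  have phi0 : phi (linform (lift e)) = 0 by apply/phiP; exists 1; rewrite mul1r.
  apply/(label_dividesE _ _ hl)/phiP.
  rewrite !ffunE eqxx (negbTE vu) eqxx rmorphB rmorphM rmorphN rmorph_int /=.
  rewrite (punctured_prod_bar hn hl phi0) mulrA mulrNN -intrM eta_sqr.
  by rewrite mul1r subrr.
apply/asboolP; split=> [e' x y _ xe ye|x e' xe' e'G]; last first.
  apply: dvd => //; apply: contra e'G => /eqP-> //; exact: sub_edge_bar.
have [e'e|ne] := eqVneq e' e.
  have -> : x = u by apply: val_inj; rewrite xe ue e'e.
  have -> : y = v by apply: val_inj; rewrite ye ve e'e.
  by rewrite e'e.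
have [e'e|neb] := eqVneq e' (bar e).
  have -> : x = v by apply: val_inj; rewrite xe ve e'e ini_bar.
  have -> : y = u by apply: val_inj; rewrite ye ue e'e ter_bar.
  by rewrite e'e label_bar -opprB; apply: label_dividesN.
apply: label_dividesD; first by apply: dvd; rewrite // xe star_ini.
apply: label_dividesN; rewrite -label_bar; apply: dvd.
- by rewrite ye star_ter.
- by apply: contra neb => /eqP <-; rewrite barK.
- by rewrite (inj_eq (inv_inj (@barK Gamma))).
Qed.

Definition edge_class : HTc G := HTcElt edge_cochain_compact.

Lemma edge_classE : linform (lift e) *: edge_class =
  point_class u - (eta nabla lift e)%:~R *: point_class v.
Proof.
apply/val_inj/ffunP => x; rewrite !ffunE.
case: (eqVneq x u) => [->|xu].
  by rewrite eq_sym (negbTE vu) scaler0 subr0 ue star_prodE.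
case: (eqVneq x v) => _; last by rewrite !scaler0 subr0.
rewrite ve (star_prod_ter _ hl) sub0r -scalerN.
by rewrite /GRing.scale /= mulNr mulrN mulrN mulrCA.
Qed.

End EdgeClass.

(** * Representing a functional by a class *)

Section Surjectivity.
Variable phi : dual (HTc G).

(** These values are forced by [pairing_point], as [Psi] is its own inverse. *)
Definition dual_cochain : cochain G :=
  [ffun u => (Psi (val u))%:~R * (phi (point_class u) : R)].

Lemma dual_cochain_class : dual_cochain \in @HT_pred k Gamma G.
Proof.
apply/asboolP=> e u v eG ue ve; apply/(label_dividesE _ _ hl).
(* Applying [phi] to [edge_classE] exhibits this quotient, once [Psi_ter] absorbs [eta] into the
   sign at [v]. *)
exists ((Psi (val u))%:~R * (phi (edge_class eG ue ve) : R)).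
have h : linform (lift e) * (phi (edge_class eG ue ve) : R) =
    (phi (point_class u) : R)
    - (eta nabla lift e)%:~R * (phi (point_class v) : R).
  transitivity (phi (linform (lift e) *: edge_class eG ue ve) : R).
    by rewrite linearZ.
  by rewrite edge_classE linearB linearZ.
rewrite -[RHS]mulrA [_ * linform _]mulrC h !ffunE ve Psi_ter // -ue.
by rewrite mulrBr intrM !mulrA.
Qed.

Definition dual_class : HT G := HTElt dual_cochain_class.

Lemma duality_point u :
  duality dual_class (point_class u) = phi (point_class u).
Proof.
by rewrite [LHS]pairing_point ffunE mulrA PsiR_sqr mul1r.
Qed.

(** At each vertex only its own point class contributes, and the labels of the edges not starting
    there complete [star_prod] to the product of all labels. *)
Lemma compact_class_point_sum b :
  (\prod_e linform (lift e)) *: b =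
  \sum_u (val b u * \prod_(e | e \notin star (val u)) linform (lift e))
    *: point_class u.
Proof.
apply/val_inj/ffunP => x; rewrite raddf_sum sum_ffunE ffunE.
rewrite [RHS](bigD1 x) //= [X in _ + X]big1 => [|y yx]; last first.
  by rewrite !ffunE eq_sym (negbTE yx) scaler0.
rewrite !ffunE eqxx addr0 /GRing.scale /=.
by rewrite (bigID (mem (star (val x)))) /= mulrC mulrAC mulrA.
Qed.

Lemma duality_dual_class : duality dual_class = phi.
Proof.
apply: dualP => b.
have M0 : \prod_e linform (lift e) != 0 :> R.
  by apply/prodf_neq0 => e _; apply: linform_lift_neq0.
(* The values lie in a domain, so equality may be tested after multiplication by all labels, where
   [b] becomes a combination of point classes. *)
apply: (mulfI M0).
have scaleM (f : dual (HTc G)) c b' : c * (f b' : R) = f (c *: b').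
  by rewrite linearZ.
rewrite !scaleM compact_class_point_sum !linear_sum; apply: eq_bigr => u _.
by rewrite !linearZ duality_point.
Qed.

End Surjectivity.

End Duality.

Theorem theorem1p3 (k : nat) (Gamma : gkm_graph k)
    (hGamma : orientable Gamma) (G : subgraph Gamma)
    (nabla : edge Gamma -> edge Gamma -> edge Gamma)
    (hnabla : compatible_connection nabla)
    (lift : edge Gamma -> 'rV[int]_k) (hlift : is_lift lift)
    (v0 : vertex Gamma) :
  exists D : {linear HT G -> dual (HTc G)},
    (forall (a : HT G) (b : HTc G),
       tofrac (D a b : HBT k) =
       integral nabla lift v0 (extend0 (fun u => val a u * val b u))) /\
    bijective D.
Proof.
exists (duality hGamma v0 hnabla hlift (G := G)); split=> [a b|].
  exact: pairingE.
exists (dual_class hGamma v0 hnabla hlift (G := G)) => [a|phi].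
  (* A right inverse of an injective map is also a left inverse. *)
  exact/(duality_inj (duality_dual_class _ _ _ _ _)).
exact: duality_dual_class.
Qed.
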